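(* Let $(L,\cdot)$ be a Bol-SBL with Nuclear-holomorph $H(L)$. Then $H(L)$ is a Bruck-SBRL if and only if $$(x\beta^{-1})J\cdot yJ=(x\cdot y\alpha^{-1})J\quad\text{for all }x,y\in L\qquad\text{and}\qquad \alpha\beta=\beta\alpha,$$ for all $\alpha,\beta\in Aum(L,\cdot)$. Hence, when these equivalent conditions hold: 1. $L$ is a Moufang-SML and a Bruck-SBRL. 2. $H(L)$ is a Moufang-SML. 3. If $L$ is also an A-SAL with Centrum-holomorph $H(L)$, then $L$ is a Kikkawa-SKWL and so is $H(L)$.
   Context: Mappings are written on the right, so $\alpha\beta$ means first $\alpha$, then $\beta$. For a loop $(L,\cdot)$ let $Aum(L,\cdot)$ be its automorphism group. The holomorph $H(L)=(H,\circ)$ is the loop on the set $H$ of pairs $(\alpha,x)$ with $\alpha\in Aum(L,\cdot)$, $x\in L$, with operation $(\alpha,x)\circ(\beta,y)=(\alpha\beta,\ x\beta\cdot y)$. The symbol $x^{-1}$ denotes the inverse of $x$, and $J:x\mapsto x^{-1}$. The nucleus $N(L)$ is the set of $a\in L$ with $a\cdot xy=ax\cdot y$, $x\cdot ay=xa\cdot y$, $x\cdot ya=xy\cdot a$ for all $x,y\in L$; the centrum $C(L)$ is the set of $a\in L$ with $ax=xa$ for all $x\in L$. $H(L)$ is called a Nuclear-holomorph (resp. Centrum-holomorph) of $L$ if $x^{-1}\cdot x\alpha\in N(L)$ or $x\alpha\cdot x^{-1}\in N(L)$ (resp. $x^{-1}\cdot x\alpha\in C(L)$ or $x\alpha\cdot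 x^{-1}\in C(L)$) for all $x\in L$ and $\alpha\in Aum(L,\cdot)$. A Bol loop is a loop satisfying the (right) Bol identity $(xy\cdot z)y=x(yz\cdot y)$. A Moufang loop is a loop satisfying $xy\cdot zx=(x\cdot yz)x$. A loop has the automorphic inverse property (AIP) if $(xy)^{-1}=x^{-1}y^{-1}$ for all $x,y$, and the inverse property (IP) if every element $x$ has an inverse $x^{-1}$ such that $x^{-1}\cdot(x\cdot y)=y=(y\cdot x)\cdot x^{-1}$ for all $y$. An A-loop is a loop all of whose inner mappings (the elements of the multiplication group, generated by all left and right translations, that fix the identity element) are automorphisms. A Bruck loop is a Bol loop with the AIP. A Kikkawa loop is an A-loop with the IP and the AIP. A loop is a SBL (resp. SML, SBRL, SAL, SKWL) if it has at least one non-trivial subloop that is a Bol loop (resp. Moufang loop, Bruck loop, A-loop, Kikkawa loop). A Bol-SBL (resp. Moufang-SML, Bruck-SBRL, A-SAL, Kikkawa-SKWL) is a loop that is itself a Bol loop (resp. Moufang loop, Bruck loop, A-loop, Kikkawa loop) and also a SBL (resp. SML, SBRL, SAL, SKWL). *)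

(* Defs.v *)
From HB Require Import structures.
From mathcomp Require Import all_boot.
From mathcomp Require Import boolp.

Set Implicit Arguments.
Unset Strict Implicit.
Unset Printing Implicit Defensive.

Local Open Scope group_scope.

(* Loops are presented equationally: [ldiv a b] and [rdiv b a] are the unique
   solutions of [a * x = b] and [y * a = b]. *)
HB.mixin Record BaseUMagma_isLoop G of BaseUMagma G := {
  ldiv : G -> G -> G;
  rdiv : G -> G -> G;
  lmul1 : left_id (1 : G) *%g;
  lmulr1 : right_id (1 : G) *%g;
  mul_ldiv : forall a b : G, a * ldiv a b = b;
  ldiv_mul : forall a b : G, ldiv a (a * b) = b;
  mul_rdiv : forall b a : G, rdiv b a * a = b;
  rdiv_mul : forall b a : G, rdiv (b * a) a = b
}.

#[short(type="loopType")]
HB.structure Definition Loop := {G of BaseUMagma_isLoop G & BaseUMagma G}.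

(* The map J.  In a general loop this is only the right inverse of [x]; see
   [two_sided_inverses]. *)
Definition linv (L : loopType) (x : L) : L := ldiv x 1.

Definition two_sided_inverses (L : loopType) :=
  forall x : L, x * linv x = 1 /\ linv x * x = 1.

Record subloop (L : loopType) := Subloop {
  subloop_pred :> L -> Prop;
  subloop1 : subloop_pred 1;
  subloopM : forall x y, subloop_pred x -> subloop_pred y ->
    subloop_pred (x * y);
  subloop_ldiv : forall x y, subloop_pred x -> subloop_pred y ->
    subloop_pred (ldiv x y);
  subloop_rdiv : forall x y, subloop_pred x -> subloop_pred y ->
    subloop_pred (rdiv x y)
}.

Definition subloop_of (L : loopType) (S : subloop L) := {x : L | S x}.

Section SubloopLoop.
Variables (L : loopType) (S : subloop L).
Implicit Types a b : subloop_of S.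

Definition sub_one : subloop_of S := exist _ 1 (subloop1 S).
Definition sub_mul a b : subloop_of S :=
  exist _ (sval a * sval b) (subloopM (svalP a) (svalP b)).
Definition sub_ldiv a b : subloop_of S :=
  exist _ (ldiv (sval a) (sval b)) (subloop_ldiv (svalP a) (svalP b)).
Definition sub_rdiv a b : subloop_of S :=
  exist _ (rdiv (sval a) (sval b)) (subloop_rdiv (svalP a) (svalP b)).

Lemma subloop_ext a b : sval a = sval b -> a = b.
Proof.
case: a b => [a Sa] [b Sb] /= eq_ab; subst b.
by rewrite (Prop_irrelevance Sa Sb).
Qed.

HB.instance Definition _ := hasMul.Build (subloop_of S) sub_mul.
HB.instance Definition _ := hasOne.Build (subloop_of S) sub_one.

Fact sub_mul1 : left_id (1 : subloop_of S) *%g.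
Proof. by move=> a; apply: subloop_ext; apply: lmul1. Qed.
Fact sub_mulr1 : right_id (1 : subloop_of S) *%g.
Proof. by move=> a; apply: subloop_ext; apply: lmulr1. Qed.
Fact sub_mul_ldiv a b : a * sub_ldiv a b = b.
Proof. by apply: subloop_ext; apply: mul_ldiv. Qed.
Fact sub_ldiv_mul a b : sub_ldiv a (a * b) = b.
Proof. by apply: subloop_ext; apply: ldiv_mul. Qed.
Fact sub_mul_rdiv b a : sub_rdiv b a * a = b.
Proof. by apply: subloop_ext; apply: mul_rdiv. Qed.
Fact sub_rdiv_mul b a : sub_rdiv (b * a) a = b.
Proof. by apply: subloop_ext; apply: rdiv_mul. Qed.

HB.instance Definition _ := BaseUMagma_isLoop.Build (subloop_of S)
  sub_mul1 sub_mulr1 sub_mul_ldiv sub_ldiv_mul sub_mul_rdiv sub_rdiv_mul.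
End SubloopLoop.

(* An automorphism carries its inverse map as data; by [aum_ext] this does not
   affect equality. *)
Record aum (L : loopType) := Aum {
  aum_fun :> L -> L;
  aum_inv : L -> L;
  aumK : cancel aum_fun aum_inv;
  aumVK : cancel aum_inv aum_fun;
  aumM : {morph aum_fun : x y / x * y}
}.

Section Automorphisms.
Variable L : loopType.
Implicit Types a b c : aum L.

Lemma aum_ext a b : a =1 b -> a = b.
Proof.
case: a b => [f f' fK f'K fM] [g g' gK g'K gM] /= eq_fg.
have eqf : f = g by apply: funext.
subst g.
have eqf' : f' = g' by apply: funext => x; rewrite -[in LHS](g'K x) fK.
subst g'.
by rewrite (Prop_irrelevance fK gK) (Prop_irrelevance f'K g'K)
           (Prop_irrelevance fM gM).
Qed.

Definition aum1 : aum L :=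
  @Aum L id id (fun _ => erefl) (fun _ => erefl) (fun _ _ => erefl).

Fact aumV_morph a : {morph aum_inv a : x y / x * y}.
Proof. by move=> x y; apply: (can_inj (aumK a)); rewrite aumM !aumVK. Qed.
Definition aumV a : aum L := Aum (aumVK a) (aumK a) (@aumV_morph a).

Fact aum_comp_morph a b : {morph b \o a : x y / x * y}.
Proof. by move=> x y /=; rewrite !aumM. Qed.
(* Mappings act on the right: [aum_comp a b] is first [a], then [b]. *)
Definition aum_comp a b : aum L :=
  Aum (can_comp (aumK b) (aumK a)) (can_comp (aumVK a) (aumVK b))
      (@aum_comp_morph a b).

Lemma aum1E a : a 1 = 1.
Proof.
have a11 : a 1 * a 1 = a 1 by rewrite -aumM lmul1.
by rewrite -[LHS](ldiv_mul (a 1)) a11 -[X in ldiv _ X](lmulr1 (a 1)) ldiv_mul.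
Qed.
End Automorphisms.

Definition holomorph (L : loopType) := (aum L * L)%type.

Section Holomorph.
Variable L : loopType.
Implicit Types p q : holomorph L.

Definition hol_one : holomorph L := (aum1 L, 1).
Definition hol_mul p q : holomorph L := (aum_comp p.1 q.1, q.1 p.2 * q.2).
Definition hol_ldiv p q : holomorph L :=
  let c := aum_comp (aumV p.1) q.1 in (c, ldiv (c p.2) q.2).
Definition hol_rdiv q p : holomorph L :=
  (aum_comp q.1 (aumV p.1), aumV p.1 (rdiv q.2 p.2)).

HB.instance Definition _ := hasMul.Build (holomorph L) hol_mul.
HB.instance Definition _ := hasOne.Build (holomorph L) hol_one.

Fact hol_mul1 : left_id (1 : holomorph L) *%g.
Proof.
by case=> a x; congr pair; [apply: aum_ext | rewrite /= aum1E lmul1].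
Qed.
Fact hol_mulr1 : right_id (1 : holomorph L) *%g.
Proof. by case=> a x; congr pair; [apply: aum_ext | rewrite /= lmulr1]. Qed.
Fact hol_mul_ldiv p q : p * hol_ldiv p q = q.
Proof.
case: p q => [a x] [b y]; congr pair; last by rewrite /= mul_ldiv.
by apply: aum_ext => z /=; rewrite aumK.
Qed.
Fact hol_ldiv_mul p q : hol_ldiv p (p * q) = q.
Proof.
case: p q => [a x] [b y]; congr pair; last by rewrite /= aumVK ldiv_mul.
by apply: aum_ext => z /=; rewrite aumVK.
Qed.
Fact hol_mul_rdiv q p : hol_rdiv q p * p = q.
Proof.
case: p q => [a x] [b y]; congr pair; last by rewrite /= aumVK mul_rdiv.
by apply: aum_ext => z /=; rewrite aumVK.
Qed.
Fact hol_rdiv_mul q p : hol_rdiv (q * p) p = q.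
Proof.
case: p q => [a x] [b y]; congr pair; last by rewrite /= rdiv_mul aumK.
by apply: aum_ext => z /=; rewrite aumK.
Qed.

HB.instance Definition _ := BaseUMagma_isLoop.Build (holomorph L)
  hol_mul1 hol_mulr1 hol_mul_ldiv hol_ldiv_mul hol_mul_rdiv hol_rdiv_mul.
End Holomorph.

Definition nucleus (L : loopType) (a : L) :=
  forall x y : L, [/\ a * (x * y) = (a * x) * y,
                      x * (a * y) = (x * a) * y
                    & x * (y * a) = (x * y) * a].

Definition centrum (L : loopType) (a : L) := forall x : L, a * x = x * a.

Definition nuclear_holomorph (L : loopType) :=
  forall (x : L) (a : aum L),
    nucleus (linv x * a x) \/ nucleus (a x * linv x).

Definition centrum_holomorph (L : loopType) :=
  forall (x : L) (a : aum L),
    centrum (linv x * a x) \/ centrum (a x * linv x).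

Definition is_bol (L : loopType) :=
  forall x y z : L, ((x * y) * z) * y = x * ((y * z) * y).

Definition is_moufang (L : loopType) :=
  forall x y z : L, (x * y) * (z * x) = (x * (y * z)) * x.

Definition is_aip (L : loopType) :=
  two_sided_inverses L /\
  forall x y : L, linv (x * y) = linv x * linv y.

Definition is_ip (L : loopType) :=
  forall x y : L, linv x * (x * y) = y /\ (y * x) * linv x = y.

Inductive mult_group (L : loopType) : (L -> L) -> Prop :=
| Mlt_left a : mult_group (fun x => a * x)
| Mlt_right a : mult_group (fun x => x * a)
| Mlt_id : mult_group id
| Mlt_comp f g : mult_group f -> mult_group g -> mult_group (g \o f)
| Mlt_inv f g : mult_group f -> cancel f g -> cancel g f -> mult_group g.

Definition is_aloop (L : loopType) :=
  forall f : L -> L, mult_group f -> f 1 = 1 -> exists a : aum L, f =1 a.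

Definition is_bruck (L : loopType) := is_bol L /\ is_aip L.

Definition is_kikkawa (L : loopType) := [/\ is_aloop L, is_ip L & is_aip L].

(* Non-trivial means different from [{1}]; the whole loop is allowed. *)
Definition has_nontrivial_subloop (P : loopType -> Prop) (L : loopType) :=
  exists S : subloop L, (exists2 x, S x & x <> 1) /\ P (subloop_of S).

Definition SBL := has_nontrivial_subloop is_bol.
Definition SML := has_nontrivial_subloop is_moufang.
Definition SBRL := has_nontrivial_subloop is_bruck.
Definition SAL := has_nontrivial_subloop is_aloop.
Definition SKWL := has_nontrivial_subloop is_kikkawa.

Definition Bol_SBL (L : loopType) := is_bol L /\ SBL L.
Definition Moufang_SML (L : loopType) := is_moufang L /\ SML L.
Definition Bruck_SBRL (L : loopType) := is_bruck L /\ SBRL L.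
Definition A_SAL (L : loopType) := is_aloop L /\ SAL L.
Definition Kikkawa_SKWL (L : loopType) := is_kikkawa L /\ SKWL L.

(* Main.v *)
Require Import Defs.
From mathcomp Require Import all_boot.

(** The condition on [L] is the automorphic inverse property of the holomorph,
    read off componentwise: the first components say that automorphisms
    commute, the second ones give the displayed identity.

    This condition is very restrictive.  Taking both automorphisms trivial
    shows that [L] has the AIP; comparing a general [beta] with the identity
    then gives [linv (beta^-1 x) = linv x], so that [L] has no automorphism but
    the identity.  On the other hand a Bol loop with the AIP has many
    automorphisms.  The map [J] is one, hence [x * x = 1] for all [x].  In a Bol
    loop of exponent 2, the right inner mappings
    [z |-> ((z * x) * y) * (x * y)] are automorphisms too
    ([bol_exp2_right_inner_morph]), and their triviality is associativity.
    Thus [L] is an elementary abelian 2-group ([rigid_bruck_abelian]).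
    Its holomorph, whose first components are all trivial, is again a
    commutative group, and every class of loops in the theorem contains the
    commutative groups; the required subloops can be taken to be the whole
    loops. *)

Set Implicit Arguments.
Unset Strict Implicit.
Unset Printing Implicit Defensive.

Local Open Scope group_scope.

(** * Inverses and automorphisms in loops *)

Definition abelian_loop (L : loopType) :=
  associative (fun x y : L => x * y) /\ commutative (fun x y : L => x * y).

Definition nontrivial_loop (L : loopType) := exists x : L, x <> 1.

Definition rigid_loop (L : loopType) := forall a : aum L, a =1 id.

Section LoopBasics.
Variable L : loopType.
Implicit Types x y z : L.

Lemma loop_mulIl x : injective (fun y => x * y).
Proof. by move=> y z /(congr1 (ldiv x)); rewrite !ldiv_mul. Qed.

Lemma loop_mulIr x : injective (fun y => y * x).
Proof. by move=> y z /(congr1 (fun t => rdiv t x)); rewrite !rdiv_mul. Qed.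

Lemma mul_linv x : x * linv x = 1.
Proof. exact: mul_ldiv. Qed.

Lemma linvP x y : x * y = 1 -> linv x = y.
Proof. by move=> xy1; apply: (@loop_mulIl x); rewrite mul_linv xy1. Qed.

Lemma linv1 : linv (1 : L) = 1.
Proof. by apply: linvP; rewrite lmul1. Qed.

Lemma aum_linv (a : aum L) x : a (linv x) = linv (a x).
Proof. by apply/esym/linvP; rewrite -aumM mul_linv aum1E. Qed.

Lemma two_sided_linvK : two_sided_inverses L -> involutive (@linv L).
Proof. by move=> inv2 x; apply: linvP; case: (inv2 x). Qed.

End LoopBasics.

(** * Commutative groups as loops *)

Section Abelian.
Variable L : loopType.
Hypothesis abL : abelian_loop L.

Let assoc (x y z : L) : x * (y * z) = x * y * z := abL.1 x y z.
Let comm (x y : L) : x * y = y * x := abL.2 x y.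

Lemma abelian_bol : is_bol L.
Proof. by move=> x y z; rewrite !assoc. Qed.

Lemma abelian_moufang : is_moufang L.
Proof. by move=> x y z; rewrite !assoc. Qed.

Lemma abelian_aip : is_aip L.
Proof.
split=> [x|x y]; first by split; [|rewrite comm]; apply: mul_linv.
by apply: linvP; rewrite assoc -(assoc x) (comm y) assoc mul_linv lmul1 mul_linv.
Qed.

Lemma abelian_bruck : is_bruck L.
Proof. by split; [apply: abelian_bol | apply: abelian_aip]. Qed.

Lemma abelian_ip : is_ip L.
Proof.
move=> x y; split; last by rewrite -assoc mul_linv lmulr1.
by rewrite assoc (comm _ x) mul_linv lmul1.
Qed.

Lemma abelian_mult_group f : mult_group f -> forall x : L, f x = f 1 * x.
Proof.
elim=> [a x|a x|x|f1 f2 _ IH1 _ IH2 x|f1 f2 _ IH f1K f2K x] /=.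
- by rewrite lmulr1.
- by rewrite lmul1 comm.
- by rewrite lmul1.
- by rewrite IH2 IH1 assoc -IH2.
- by apply: (can_inj f1K); rewrite f2K IH assoc -IH f2K lmul1.
Qed.

(** Since the multiplication group consists of translations, its only element
    fixing 1 is the identity. *)
Lemma abelian_aloop : is_aloop L.
Proof.
by move=> f /abelian_mult_group fE f1; exists (aum1 L) => x; rewrite fE f1 lmul1.
Qed.

Lemma abelian_kikkawa : is_kikkawa L.
Proof. by split; [apply: abelian_aloop|apply: abelian_ip|apply: abelian_aip]. Qed.

Lemma abelian_subloop (S : subloop L) : abelian_loop (subloop_of S).
Proof.
by split=> [x y z|x y]; apply: subloop_ext; [apply: assoc | apply: comm].
Qed.

End Abelian.

Definition full_subloop (L : loopType) : subloop L :=
  @Subloop L (fun _ => True) I (fun _ _ _ _ => I) (fun _ _ _ _ => I)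
    (fun _ _ _ _ => I).

Lemma abelian_has_subloop (P : loopType -> Prop) (L : loopType) :
    (forall M : loopType, abelian_loop M -> P M) ->
  abelian_loop L -> nontrivial_loop L -> has_nontrivial_subloop P L.
Proof.
move=> abP abL [x x_n1]; exists (full_subloop L); split; first by exists x.
exact/abP/abelian_subloop.
Qed.

Lemma has_subloop_nontrivial (P : loopType -> Prop) (L : loopType) :
  has_nontrivial_subloop P L -> nontrivial_loop L.
Proof. by case=> S [[x _ x_n1] _]; exists x. Qed.

(** * Bol loops of exponent 2 *)

Section Bol.
Variable L : loopType.
Hypothesis bolL : is_bol L.
Implicit Types x y z : L.

(** The right inverse property: put [z = linv y] in the Bol identity and
    cancel the last factor [y]. *)
Lemma bol_mulK x y : (x * y) * linv y = x.
Proof. by apply: (@loop_mulIr _ y); rewrite bolL mul_linv lmul1. Qed.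

Lemma bol_two_sided_inverses : two_sided_inverses L.
Proof.
move=> x; split; first exact: mul_linv.
by apply: (@loop_mulIr _ (linv x)); rewrite bol_mulK lmul1.
Qed.

Hypothesis exp2 : forall x, x * x = 1.

Lemma bol_exp2_mulK x y : (x * y) * y = x.
Proof. by rewrite -[in RHS](bol_mulK x y) (linvP (exp2 y)). Qed.

(** The Bol identity as an autotopism whose first and third components are
    both the right translation by [y]; for this the square of that translation
    must be the identity. *)
Lemma bol_exp2_autotopism x y z : (x * z) * y = (x * y) * ((y * z) * y).
Proof. by rewrite -bolL bol_exp2_mulK. Qed.

Definition right_inner x y z := ((z * x) * y) * (x * y).

(** Composing the autotopisms of [x], [y] and [x * y] gives an autotopism
    [(g, p, g)] with [g = right_inner x y].  As [g 1 = 1], evaluating it at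
    [1 * v] shows [p = g], so that [g] is an automorphism. *)
Lemma bol_exp2_right_inner_morph x y :
  {morph right_inner x y : u v / u * v}.
Proof.
pose p t z := (t * z) * t.
have autotop u v :
    right_inner x y (u * v) = right_inner x y u * p (x * y) (p y (p x v)).
  by rewrite /right_inner (bol_exp2_autotopism u) (bol_exp2_autotopism _ y)
             (bol_exp2_autotopism _ (x * y)).
have g1 : right_inner x y 1 = 1 by rewrite /right_inner lmul1 exp2.
move=> u v; rewrite autotop; congr (_ * _).
by rewrite -[v in RHS]lmul1 autotop g1 lmul1.
Qed.

Fact right_innerK x y :
  cancel (right_inner x y) (fun z => ((z * (x * y)) * y) * x).
Proof. by move=> z; rewrite /right_inner !bol_exp2_mulK. Qed.

Fact right_innerVK x y :
  cancel (fun z => ((z * (x * y)) * y) * x) (right_inner x y).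
Proof. by move=> z; rewrite /right_inner !bol_exp2_mulK. Qed.

Definition right_inner_aum x y : aum L :=
  Aum (right_innerK x y) (right_innerVK x y) (@bol_exp2_right_inner_morph x y).

Lemma rigid_bol_exp2_assoc :
  rigid_loop L -> associative (fun x y : L => x * y).
Proof.
move=> rigid z x y; apply: (@loop_mulIr _ (x * y)).
by rewrite bol_exp2_mulK; apply/esym/(rigid (right_inner_aum x y)).
Qed.

End Bol.

(** * Loops without non-trivial automorphisms *)

Section Rigid.
Variable L : loopType.
Hypothesis rigid : rigid_loop L.

Lemma rigid_aip_exp2 : is_aip L -> forall x : L, x * x = 1.
Proof.
case=> inv2 linvM x.
pose j := Aum (two_sided_linvK inv2) (two_sided_linvK inv2) linvM.
by rewrite -{2}(rigid j x) mul_linv.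
Qed.

(** A rigid Bruck loop has exponent 2 because [J] is an automorphism, and it
    is associative because the right inner mappings are.  Commutativity then
    follows from [(x * y) * (y * x) = 1] as in a group of exponent 2. *)
Lemma rigid_bruck_abelian : is_bruck L -> abelian_loop L.
Proof.
move=> [bolL aipL]; have exp2 := rigid_aip_exp2 aipL.
have assoc := rigid_bol_exp2_assoc bolL exp2 rigid; split=> // x y.
apply: (@loop_mulIr _ (y * x)); rewrite exp2.
by rewrite assoc (bol_exp2_mulK bolL exp2) exp2.
Qed.

Lemma rigid_holomorph_abelian : abelian_loop L -> abelian_loop (holomorph L).
Proof.
case=> assoc comm; split=> [[a x] [b y] [c z]|[a x] [b y]]; congr pair.
- exact: aum_ext.
- by rewrite /= !rigid; apply: assoc.
- by apply: aum_ext => z; rewrite /= !rigid.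
- by rewrite /= !rigid; apply: comm.
Qed.

End Rigid.

Lemma holomorph_nontrivial (L : loopType) :
  nontrivial_loop L -> nontrivial_loop (holomorph L).
Proof. by case=> x x_n1; exists (aum1 L, x) => -[]. Qed.

(** * The automorphic inverse property of the holomorph *)

Section HolomorphAIP.
Variable L : loopType.

Definition twisted_aip := forall alpha beta : aum L,
  (forall x y : L,
     linv (aumV beta x) * linv y = linv (x * aumV alpha y)) /\
  aum_comp alpha beta = aum_comp beta alpha.

Lemma holomorph_linv (a : aum L) (x : L) :
  linv ((a, x) : holomorph L) = (aumV a, linv (aumV a x)).
Proof. by congr pair; apply: aum_ext. Qed.

(** The AIP of the holomorph compares the inverses of products.  Its first
    component says that the inverses of automorphisms commute, so it is used at
    [alpha^-1] and [beta^-1]; its second component becomes the identity of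
    [twisted_aip] at the elements [(alpha, alpha x)] and [(beta, beta y)]. *)
Lemma holomorph_aip_twisted : is_aip (holomorph L) -> twisted_aip.
Proof.
case=> _ linvM alpha beta.
have linvME a b x y := linvM (a, x) (b, y).
split=> [x y|].
  have := congr1 snd (linvME alpha beta (alpha x) (beta y)).
  rewrite (holomorph_linv (aum_comp alpha beta)) !holomorph_linv /=.
  rewrite !aumK -(aumM beta) !aumK aumV_morph aumK.
  by rewrite [aum_inv beta _](aum_linv (aumV beta)) /= => <-.
have := congr1 fst (linvME (aumV alpha) (aumV beta) 1 1).
rewrite (holomorph_linv (aum_comp (aumV alpha) (aumV beta))) !holomorph_linv /=.
move=> eq_ab; apply: aum_ext => z.
by have /= := congr1 (fun a : aum L => a z) eq_ab.
Qed.

Hypothesis twisted : twisted_aip.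

Lemma twisted_aip_linvM (x y : L) : linv (x * y) = linv x * linv y.
Proof. by have [/(_ x y) <-] := twisted (aum1 L) (aum1 L). Qed.

Hypothesis inv2 : two_sided_inverses L.

(** The identity for [alpha = 1] has a right-hand side that does not involve
    [beta], while at [y = 1] its left-hand side is [linv (beta^-1 x)]. *)
Lemma twisted_aip_rigid : rigid_loop L.
Proof.
move=> beta x; have [/(_ (beta x) 1) /=] := twisted (aum1 L) beta.
by rewrite aumK linv1 !lmulr1 => /(can_inj (two_sided_linvK inv2)) <-.
Qed.

End HolomorphAIP.

Lemma twisted_aip_abelian (L : loopType) :
    is_bol L -> twisted_aip L -> abelian_loop L /\ abelian_loop (holomorph L).
Proof.
move=> bolL tw; have inv2 := bol_two_sided_inverses bolL.
have rigid := twisted_aip_rigid tw inv2.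
have abL : abelian_loop L.
  by apply: rigid_bruck_abelian => //; split=> //; split=> //;
     apply: twisted_aip_linvM.
by split=> //; apply: rigid_holomorph_abelian.
Qed.

Theorem theorem3p18 (L : loopType) (bolL : Bol_SBL L)
    (nucH : nuclear_holomorph L) :
  (Bruck_SBRL (holomorph L) <->
     forall alpha beta : aum L,
       (forall x y : L,
          linv (aumV beta x) * linv y = linv (x * aumV alpha y)) /\
       aum_comp alpha beta = aum_comp beta alpha)
  /\
  (Bruck_SBRL (holomorph L) ->
     [/\ Moufang_SML L /\ Bruck_SBRL L,
         Moufang_SML (holomorph L)
       & A_SAL L -> centrum_holomorph L ->
         Kikkawa_SKWL L /\ Kikkawa_SKWL (holomorph L)]).
Proof.
case: bolL => bolL /has_subloop_nontrivial ntL.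
have ntH := holomorph_nontrivial ntL.
have both (P : loopType -> Prop) (M : loopType) :
    (forall N : loopType, abelian_loop N -> P N) ->
    abelian_loop M -> nontrivial_loop M -> P M /\ has_nontrivial_subloop P M.
  by move=> abP abM ntM; split; [apply: abP | apply: abelian_has_subloop].
have twistedH : Bruck_SBRL (holomorph L) -> twisted_aip L.
  by case=> [[_ aipH] _]; apply: holomorph_aip_twisted.
split; [split=> // tw | move=> /twistedH tw];
  have [abL abH] := twisted_aip_abelian bolL tw.
  exact: (both _ _ abelian_bruck).
split; first by split; apply: both => //;
  [exact: abelian_moufang | exact: abelian_bruck].
  exact: (both _ _ abelian_moufang).
by move=> _ _; split; apply: both => //; exact: abelian_kikkawa.
Qed.
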